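(* Let $B=\underline{z}_0\, \underline{z}_1\,\cdots \,\underline{z}_{n-1}$ be a standard representative of a band of type $0$. Consider the following property $(++)$ of $B$: if there are rotated subpatterns $U,V$ of $B$ such that $B\sim_{r,(0)}\underline{x}\,U\,\underline{x}\,V$, then for all rotated subpatterns $W$ of $B$ we have $B\not\sim_{r,(0)}\underline{y}\,U\,\underline{y}\,W$. Then $B$ has property $(++)$ if and only if there exist a positive integer $\ell$, an $(\ell-1)$-tuple $(i_1,\ldots, i_{\ell-1})$ with $i_j\in\{0,1\}$ modulo $2$, and an $(\ell-1)$-tuple $(a_1,\ldots,a_{\ell-1})$ of positive integers such that $$B\sim_{r,(0)} \underline{x}^{(\ell)}\; \mbox{ or }\; B\sim_{r,(0)} \underline{y}^{(\ell)},$$ where $\underline{x}^{(\ell)},\underline{y}^{(\ell)}$ are the words associated to these tuples. Moreover, if $B$ has property $(++)$, then $B$ allows exactly one wrap-around, i.e. there is exactly one $\omega\in\{0,1,\ldots,n-1\}$ such that $B$ allows a wrap-around at $\omega$.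
   Context: Words are formal words (concatenations) in the letters $\alpha,\rho,\xi,\beta,\delta,\lambda$ and their formal inverses; these letters are the arrows of the quiver with vertices $0,1,2$, loops $\alpha,\rho,\xi$ at $0,1,2$, and arrows $\beta:0\to1$, $\delta:1\to2$, $\lambda:2\to0$. For a word $w=w_1\cdots w_n$ with $w_i$ an arrow or formal inverse, consecutive letters satisfy $s(w_i)=e(w_{i+1})$, where $s,e$ denote starting and end vertex and $s(\zeta^{-1})=e(\zeta)$, $e(\zeta^{-1})=s(\zeta)$. $1_0$ is the empty word at vertex $0$ (neutral for concatenation). Let $J=\{\alpha^2,\rho^2,\xi^2,\alpha\lambda,\lambda\xi,\xi\delta,\delta\rho,\rho\beta,\beta\alpha,\lambda\delta\beta,\beta\lambda\delta,\delta\beta\lambda\}$. A word $w=w_1\cdots w_n$ ($n\ge1$) with $s(w_n)=e(w_1)$ represents a band if $w_i\ne w_{i+1}^{-1}$, $w_n\ne w_1^{-1}$, $w$ is not a power of a smaller word, and for all positive integers $m$ no subword of $w^m$ or its formal inverse lies in $J$. Words of type $0$. $\underline{x}=\lambda\xi^{-1}\delta\beta\alpha^{-1}$ and $\underline{y}=\lambda\delta\rho^{-1}\beta\alpha^{-1}$. A word of type $0$ is $1_0$ or $Z=\underline{z}_0\cdots\underline{z}_{n-1}$ with $n\ge1$ and all $\underline{z}_i\in\{\underline{x},\underline{y}\}$. A subpattern of $Z$ is $1_0$ or $\underline{z}_i\cdots\underline{z}_j$ for some $0\le i\le j\le n-1$. For $0\le i\le n-1$ put $\rho^{(0)}_i(Z)=\underline{z}_i\underline{z}_{i+1}\cdots\underline{z}_{n-1}\underline{z}_0\cdots\underline{z}_{i-1}$,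 and let $Z\sim_{r,(0)}Z'$ iff $Z=\rho_i^{(0)}(Z')$ for some $i$. A standard representative of a band of type $0$ is a word $B=\underline{z}_0\cdots\underline{z}_{n-1}$ of type $0$ with $n\ge1$ that represents a band (in particular it is not a proper power). A rotated subpattern of $B$ is a subpattern of $\rho_i^{(0)}(B)$ for some $0\le i\le n-1$. For $\omega\in\{0,\dots,n-1\}$, $B$ allows a wrap-around at $\omega$ if $\underline{z}_i=\underline{z}_{\omega-i}$ for all $i$, indices modulo $n$. Inductive words. Let $\ell$ be a positive integer, $(i_1,\dots,i_{\ell-1})$ a tuple with $i_j\in\{0,1\}$ modulo $2$, and $(a_1,\dots,a_{\ell-1})$ a tuple of positive integers. Define $N_0=\underline{x}$, $N_1=\underline{y}$, and for $1\le j\le\ell-1$ $$N_{i_1,\ldots,i_j,0}(a_1,\ldots,a_j) = N_{i_1,\ldots,i_j}(a_1,\ldots,a_{j-1})^{a_j}\,N_{i_1,\ldots,i_{j-1},(i_j)+1}(a_1,\ldots,a_{j-1}),$$ $$N_{i_1,\ldots,i_j,1}(a_1,\ldots,a_j) = N_{i_1,\ldots,i_j}(a_1,\ldots,a_{j-1})^{a_j+1}\,N_{i_1,\ldots,i_{j-1},(i_j)+1}(a_1,\ldots,a_{j-1}),$$ where $(i_j)+1$ is taken modulo $2$. Put $\underline{x}^{(\ell)}=N_{i_1,\ldots,i_{\ell-1},0}(a_1,\ldots,a_{\ell-1})$ and $\underline{y}^{(\ell)}=N_{i_1,\ldots,i_{\ell-1},1}(a_1,\ldots,a_{\ell-1})$;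 for $\ell=1$, $\underline{x}^{(1)}=\underline{x}$ and $\underline{y}^{(1)}=\underline{y}$. *)

(* Defs.v *)
From HB Require Import structures.
From mathcomp Require Import all_boot all_algebra.
Set Implicit Arguments.
Unset Strict Implicit.
Unset Printing Implicit Defensive.

(** * Formal words in the arrows of the quiver *)

Variant arrow := Alpha | Rho | Xi | Beta | Delta | Lambda.

Definition arrow_code (a : arrow) : nat :=
  match a with
  | Alpha => 0 | Rho => 1 | Xi => 2 | Beta => 3 | Delta => 4 | Lambda => 5
  end.

Definition arrow_decode (n : nat) : arrow :=
  match n with
  | 0 => Alpha | 1 => Rho | 2 => Xi | 3 => Beta | 4 => Delta | _ => Lambda
  end.

Lemma arrow_codeK : cancel arrow_code arrow_decode.
Proof. by case. Qed.

HB.instance Definition _ := Equality.copy arrow (can_type arrow_codeK).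

Definition arrow_start (a : arrow) : 'I_3 :=
  match a with
  | Alpha | Beta => inord 0
  | Rho | Delta => inord 1
  | Xi | Lambda => inord 2
  end.

Definition arrow_end (a : arrow) : 'I_3 :=
  match a with
  | Alpha | Lambda => inord 0
  | Rho | Beta => inord 1
  | Xi | Delta => inord 2
  end.

(** [(a, false)] is the arrow [a] and [(a, true)] is its formal inverse. *)
Definition letter : Type := (arrow * bool)%type.

Definition dir (a : arrow) : letter := (a, false).
Definition inv (a : arrow) : letter := (a, true).

Definition letter_inv (c : letter) : letter := (c.1, ~~ c.2).

Definition letter_start (c : letter) : 'I_3 :=
  if c.2 then arrow_end c.1 else arrow_start c.1.

Definition letter_end (c : letter) : 'I_3 :=
  if c.2 then arrow_start c.1 else arrow_end c.1.

(** The base vertex of an empty word is not recorded: [[::]] is only used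
    for [1_0]. *)
Definition word : Type := seq letter.

Definition composable (w : word) : bool :=
  sorted (fun c d => letter_start c == letter_end d) w.

Definition word_inv (w : word) : word := rev (map letter_inv w).

Definition power (T : Type) (w : seq T) (k : nat) : seq T :=
  flatten (nseq k w).

Definition J : seq word :=
  map (map dir)
    [:: [:: Alpha; Alpha]; [:: Rho; Rho]; [:: Xi; Xi];
        [:: Alpha; Lambda]; [:: Lambda; Xi]; [:: Xi; Delta];
        [:: Delta; Rho]; [:: Rho; Beta]; [:: Beta; Alpha];
        [:: Lambda; Delta; Beta]; [:: Beta; Lambda; Delta];
        [:: Delta; Beta; Lambda]].

Record represents_band (w : word) : Prop := RepresentsBand {
  band_nonempty : 0 < size w;
  band_composable : composable w;
  band_closed : forall c d : letter,
    letter_start (last c w) = letter_end (head d w);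
  band_reduced : sorted (fun c d => c != letter_inv d) w;
  band_cyclically_reduced : forall c d : letter,
    last c w <> letter_inv (head d w);
  band_primitive : forall (u : word) (k : nat),
    size u < size w -> w <> power u k;
  band_avoids_J : forall (m : nat) (u : word),
    0 < m -> infix u (power w m) -> u \notin J /\ word_inv u \notin J
}.

(** * Words of type 0 *)

(** A word of type 0 is represented by the sequence of its blocks; by
    [word_of_inj] the blocks are determined by the underlying word. *)
Variant block := X | Y.

Definition block_code (b : block) : bool := if b is Y then true else false.
Definition block_decode (b : bool) : block := if b then Y else X.

Lemma block_codeK : cancel block_code block_decode.
Proof. by case. Qed.

HB.instance Definition _ := Equality.copy block (can_type block_codeK).

Definition block_word (b : block) : word :=
  match b with
  | X => [:: dir Lambda; inv Xi; dir Delta; dir Beta; inv Alpha]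
  | Y => [:: dir Lambda; dir Delta; inv Rho; dir Beta; inv Alpha]
  end.

Definition type0_word : Type := seq block.

Definition word_of (Z : type0_word) : word := flatten (map block_word Z).

Lemma word_of_inj : injective word_of.
Proof.
by elim=> [|[] Z IH] [|[] Z'] //= [] /IH ->.
Qed.

Definition subpattern (U Z : type0_word) : bool := infix U Z.

(** [rot i Z] is [z_i ... z_(n-1) z_0 ... z_(i-1)]. *)
Definition rot_equiv (Z Z' : type0_word) : Prop :=
  exists2 i, i < size Z' & Z = rot i Z'.

Definition standard_representative (B : type0_word) : Prop :=
  0 < size B /\ represents_band (word_of B).

Definition rotated_subpattern (U B : type0_word) : Prop :=
  exists2 i, i < size B & subpattern U (rot i B).

(** [(omega + size B - i) %% size B] is [omega - i] modulo [size B]; the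
    summand [size B] avoids truncated subtraction. *)
Definition allows_wrap_around (B : type0_word) (omega : 'I_(size B)) : Prop :=
  forall i : 'I_(size B),
    nth X B i = nth X B ((omega + size B - i) %% size B).

Definition property_pp (B : type0_word) : Prop :=
  forall U V : type0_word,
    rotated_subpattern U B -> rotated_subpattern V B ->
    rot_equiv B ([:: X] ++ U ++ [:: X] ++ V) ->
    forall W : type0_word, rotated_subpattern W B ->
      ~ rot_equiv B ([:: Y] ++ U ++ [:: Y] ++ W).

(** * Inductive words *)

(** [Nword i a j b] is [N_(i_1,...,i_j,b)(a_1,...,a_j)]; the indices of the
    sequences [i] and [a] are shifted by one, so that [i_j] is
    [nth 0 i (j - 1)]. *)
Fixpoint Nword (i : seq 'Z_2) (a : seq nat) (j : nat) (b : 'Z_2) : type0_word :=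
  if j is j'.+1 then
    let ij := nth 0%R i j' in
    let aj := nth 0 a j' in
    power (Nword i a j' ij) (if b == 0%R then aj else aj.+1)
      ++ Nword i a j' (ij + 1)%R
  else if b == 0%R then [:: X] else [:: Y].

Definition xword (l : nat) (i : l.-1.-tuple 'Z_2) (a : l.-1.-tuple nat) :
  type0_word := Nword i a l.-1 0%R.

Definition yword (l : nat) (i : l.-1.-tuple 'Z_2) (a : l.-1.-tuple nat) :
  type0_word := Nword i a l.-1 1%R.

(* Main.v *)
(** Call a cyclic word unbalanced if it has cyclic factors [x U x] and [y U y];
    property (++) says that [B] is balanced. In a balanced word containing both
    letters one letter [c'] is isolated, and the maximal runs of the other letter
    [c] have length [a] or [a + 1] for some [a > 0]; hence [B] is, up to rotation,
    the image of a shorter word under the substitution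
    [x |-> c^a c'], [y |-> c^(a+1) c']. This substitution preserves and reflects
    balance and primitivity, so that by induction the balanced primitive words are
    the rotations of the words obtained from a single letter by iterating such
    substitutions, which is what the words [N] are. It also commutes with reversal
    up to rotation, so a balanced primitive [B] is a rotation of its reversal: this
    is a wrap-around, and two of them would differ by a rotation fixing [B]. *)

Require Import Defs.
From mathcomp Require Import all_boot all_algebra.
From mathcomp Require Import zify.
Set Implicit Arguments.
Unset Strict Implicit.
Unset Printing Implicit Defensive.

(** * Conjugacy, powers and primitivity of words *)

Definition conjugate (T : Type) (s t : seq T) :=
  exists u v, s = u ++ v /\ t = v ++ u.

Lemma nth_rot (T : Type) (x0 : T) s k j : k <= size s -> j < size s ->
  nth x0 (rot k s) j = nth x0 s ((k + j) %% size s).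
Proof.
move=> k_le j_lt; rewrite nth_cat size_drop nth_drop.
have [lt_kj|le_kj] := ltnP j (size s - k).
  by rewrite modn_small //; lia.
rewrite nth_take; last by lia.
have ->: k + j = size s + (j - (size s - k)) by lia.
by rewrite modnDl modn_small //; lia.
Qed.

(* Primitivity in a form that is visibly invariant under rotation. *)
Definition rot_primitive (T : Type) (s : seq T) :=
  forall i, 0 < i < size s -> rot i s <> s.

Section Conjugacy.
Variable T : eqType.
Implicit Types (s t u v w : seq T).

Lemma conjugateP s t : conjugate s t <-> exists i, s = rot i t.
Proof.
split=> [[u [v [-> ->]]] | [i ->]].
  by exists (size v); rewrite rot_size_cat.
by exists (drop i t), (take i t); rewrite cat_take_drop.
Qed.

Lemma conjugate_refl s : conjugate s s.
Proof. by exists s, [::]; rewrite cats0. Qed.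

Lemma conjugate_sym s t : conjugate s t -> conjugate t s.
Proof. by move=> [u [v [-> ->]]]; exists v, u. Qed.

Lemma conjugate_catC u v : conjugate (u ++ v) (v ++ u).
Proof. by exists u, v. Qed.

Lemma conjugate_trans t s u : conjugate s t -> conjugate t u -> conjugate s u.
Proof.
move=> /conjugateP [i ->] /conjugateP [j ->]; apply/conjugateP.
by eexists; rewrite rot_rot_add.
Qed.

Lemma conjugate_perm s t : conjugate s t -> perm_eq s t.
Proof. by move=> [u [v [-> ->]]]; rewrite perm_catC. Qed.

Lemma conjugate_rev s t : conjugate s t -> conjugate (rev s) (rev t).
Proof.
by move=> [u [v [-> ->]]]; exists (rev v), (rev u); rewrite !rev_cat.
Qed.

Lemma conjugate_flatten_map (S : eqType) (f : S -> seq T) (p q : seq S) :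
  conjugate p q -> conjugate (flatten (map f p)) (flatten (map f q)).
Proof.
move=> [u [v [-> ->]]]; exists (flatten (map f u)), (flatten (map f v)).
by rewrite !map_cat !flatten_cat.
Qed.

Lemma powerD w m n : power w (m + n) = power w m ++ power w n.
Proof. by rewrite /power nseqD flatten_cat. Qed.

Lemma power_conjugate u v m :
  power (v ++ u) m.+1 = v ++ power (u ++ v) m ++ u.
Proof.
elim: m => [|m IH]; first by rewrite /power /= cats0.
rewrite -[m.+2]add1n powerD IH.
by rewrite {1 3}/power /= !cats0 -!catA.
Qed.

Lemma flatten_map_power (S : eqType) (f : S -> seq T) (p : seq S) m :
  flatten (map f (power p m)) = power (flatten (map f p)) m.
Proof.
elim: m => // m IH.
by rewrite -add1n !powerD map_cat flatten_cat IH /power /= !cats0.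
Qed.

(** Euclid's algorithm: the shorter word is a prefix of the longer one, and removing it leaves a
    commuting pair of smaller total size. *)
Lemma commuting_power u v :
  u ++ v = v ++ u -> exists w m n, u = power w m /\ v = power w n.
Proof.
have [k] := ubnP (size u + size v); elim: k u v => // k IH u v.
wlog le_uv: u v / size u <= size v => [hw lt_k comm|].
  have [/hw|/ltnW/hw] := leqP (size u) (size v); first exact.
  by rewrite addnC => /(_ lt_k (esym comm)) [w [m [n []]]]; exists w, n, m.
case: u le_uv => [|c u] le_uv lt_k comm.
  by exists v, 0, 1; rewrite /power /= cats0.
have Dv: v = (c :: u) ++ drop (size u).+1 v.
  rewrite -{1}[v](cat_take_drop (size u).+1); congr (_ ++ _).
  have := congr1 (take (size u).+1) comm.
  by rewrite take_cat ltnn subnn take0 cats0 takel_cat.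
move: (drop _ _) Dv => v' Dv; rewrite {}Dv in comm lt_k *.
have [|| w [m [n [-> ->]]]] := IH (c :: u) v'.
- by move: lt_k; rewrite size_cat /=; lia.
- by move/eqP: comm; rewrite -[X in _ == X]catA eqseq_cat // eqxx /= => /eqP.
by exists w, m, (m + n); rewrite powerD.
Qed.

(** A nontrivial rotation fixing [s] makes the two parts of the cut commute, so both parts, and [s]
    with them, are powers of one word. *)
Lemma rot_primitiveP s :
  (forall w k, size w < size s -> s <> power w k) -> rot_primitive s.
Proof.
move=> prim i /andP[i_gt0 lt_i] rot_s.
have [|] := @commuting_power (take i s) (drop i s).
  by rewrite cat_take_drop -[LHS]rot_s.
move=> w [[|m] [n [Du Dv]]].
  by move/(congr1 size): Du; rewrite size_takel ?(ltnW lt_i) //=; lia.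
apply: (prim w (m.+1 + n)); last by rewrite powerD -Du -Dv cat_take_drop.
move/(congr1 size): Du; rewrite size_takel ?(ltnW lt_i) //.
by rewrite /power /= size_cat; lia.
Qed.

Lemma rot_primitive_conjugate s t :
  conjugate s t -> rot_primitive s -> rot_primitive t.
Proof.
move=> /conjugateP[j ->] prim i i_in rot_t.
by apply: (prim i); rewrite ?size_rot // rot_rot rot_t.
Qed.

Lemma rot_primitive_flatten_map (S : eqType) (f : S -> seq T) (p : seq S) :
  (forall x, 0 < size (f x)) ->
  rot_primitive (flatten (map f p)) -> rot_primitive p.
Proof.
move=> f_gt0 prim i /andP[i_gt0 lt_i] rot_p.
have size_gt0 q : 0 < size q -> 0 < size (flatten (map f q)).
  by case: q => //= x q _; rewrite size_cat; have := f_gt0 x; lia.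
pose F q := flatten (map f q).
have Dp: F p = F (take i p) ++ F (drop i p).
  by rewrite /F -flatten_cat -map_cat cat_take_drop.
apply: (prim (size (F (take i p)))).
  rewrite -/(F p) Dp size_cat.
  have := size_gt0 (take i p); have := size_gt0 (drop i p).
  by rewrite size_drop size_takel ?(ltnW lt_i) // /F; lia.
rewrite -/(F p) {1}Dp rot_size_cat /F -flatten_cat -map_cat.
by rewrite -[_ ++ _]/(rot i p) rot_p.
Qed.

Definition cyclic_factor u s := exists m, infix u (power s m).

Lemma cyclic_factor_conjugate u s t :
  conjugate s t -> cyclic_factor u s -> cyclic_factor u t.
Proof.
move=> [p [q [-> ->]]] [m]; exists m.+1; rewrite power_conjugate.
by rewrite infix_catl ?infix_catr.
Qed.

End Conjugacy.

Lemma rot_equivP (B C : type0_word) :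
  0 < size B -> rot_equiv B C <-> conjugate B C.
Proof.
move=> B_gt0; split=> [[i _ DB] | /[dup]]; first by apply/conjugateP; exists i.
move=> /conjugate_perm/perm_size szB /conjugateP[i ->].
have [lt_i|ge_i] := ltnP i (size C); first by exists i.
by exists 0; rewrite -?szB // rot0 rot_oversize.
Qed.

(** * Run lengths and the substitution on block words *)

Definition flip (c : block) : block := if c is X then Y else X.

Lemma block_eq_or_flip (c d : block) : d = c \/ d = flip c.
Proof. by case: c; case: d; auto. Qed.

(** A zero entry contributes a bare [flip c], so every word ending in [flip c] has this form. *)
Definition runs (c : block) (ks : seq nat) : type0_word :=
  flatten [seq rcons (nseq k c) (flip c) | k <- ks].

Lemma runs_cons c k ks : runs c (k :: ks) = nseq k c ++ flip c :: runs c ks.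
Proof. by rewrite /runs /= cat_rcons. Qed.

Lemma runs_cat c ks ks' : runs c (ks ++ ks') = runs c ks ++ runs c ks'.
Proof. by rewrite /runs map_cat flatten_cat. Qed.

Lemma runs_rcons c k ks :
  runs c (rcons ks k) = runs c ks ++ rcons (nseq k c) (flip c).
Proof. by rewrite -cats1 runs_cat /runs /= cats0. Qed.

Lemma size_runs c ks : size (runs c ks) = sumn ks + size ks.
Proof.
by elim: ks => // k ks IH; rewrite runs_cons size_cat /= IH size_nseq; lia.
Qed.

Definition subst_block (c : block) (a : nat) (d : block) : type0_word :=
  rcons (nseq (a + (d == Y)) c) (flip c).

Definition subst_word (c : block) (a : nat) (w : type0_word) : type0_word :=
  flatten (map (subst_block c a) w).

Lemma substE c a w : subst_word c a w = runs c [seq a + (d == Y) | d <- w].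
Proof. by rewrite /runs -map_comp. Qed.

Lemma subst_cons c a d w :
  subst_word c a (d :: w) = nseq (a + (d == Y)) c ++ flip c :: subst_word c a w.
Proof. by rewrite /subst_word /= cat_rcons. Qed.

Lemma subst_cat c a w w' :
  subst_word c a (w ++ w') = subst_word c a w ++ subst_word c a w'.
Proof. by rewrite /subst_word map_cat flatten_cat. Qed.

Lemma subst_conjugate c a w w' :
  conjugate w w' -> conjugate (subst_word c a w) (subst_word c a w').
Proof. exact: conjugate_flatten_map. Qed.

Lemma subst_eq0 c a w : subst_word c a w = [::] -> w = [::].
Proof. by case: w => // d w; rewrite subst_cons; case: (nseq _ _). Qed.

Lemma flip_neq c : (c == flip c) = false. Proof. by case: c. Qed.

Lemma flip_nseq_cat c k l s t :
  nseq k c ++ flip c :: s = nseq l c ++ t -> l <= k.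
Proof.
elim: k l => [|k IH] [|l] //=; first by case=> /eqP; rewrite eq_sym flip_neq.
by case=> /IH.
Qed.

Lemma flip_nseq_inj c k l s t :
  nseq k c ++ flip c :: s = nseq l c ++ flip c :: t -> k = l /\ s = t.
Proof.
move=> eq_kl; have le_lk := flip_nseq_cat eq_kl.
have le_kl := flip_nseq_cat (esym eq_kl).
have eq_k: k = l by apply/eqP; rewrite eqn_leq le_kl.
by move: eq_kl; rewrite eq_k => /eqP; rewrite eqseq_cat // eqxx => /eqP [].
Qed.

Lemma flip_nseq_split c k t p q :
  nseq k c ++ flip c :: t = p ++ q ->
  (exists2 p', p = nseq k c ++ flip c :: p' & t = p' ++ q) \/
  (exists j l, [/\ k = j + l, p = nseq j c & q = nseq l c ++ flip c :: t]).
Proof.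
elim: k p => [|k IH] [|d p] /=; first by right; exists 0, 0.
- by case=> <- ->; left; exists p.
- by right; exists 0, k.+1.
case=> <- /IH [[p' -> ->]|[j [l [-> -> ->]]]]; first by left; exists p'.
by right; exists j.+1, l.
Qed.

Lemma addn_isY_inj a : injective (fun d : block => a + (d == Y)).
Proof. by case; case=> /addnI. Qed.

Lemma rcons_nseq (T : Type) (c : T) k : rcons (nseq k c) c = nseq k.+1 c.
Proof. by rewrite -cats1 -(nseqD k 1) addn1. Qed.

Lemma subst_split_prefix c a v w s :
  subst_word c a w = subst_word c a v ++ s ->
  exists2 w', w = v ++ w' & subst_word c a w' = s.
Proof.
elim: v w => [|e v IH] w; first by exists w.
case: w => [|d w]; rewrite !subst_cons; first by case: (nseq _ _).
rewrite -catA /= => /flip_nseq_inj [/addn_isY_inj -> /IH [w' -> <-]].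
by exists w'.
Qed.

(** [flip c] occurs only at the end of a block, so each occurrence marks a cut between letters of
    [w]. *)
Lemma subst_split_flip c a w p s :
  subst_word c a w = p ++ flip c :: s ->
  exists w1 w2, [/\ w = w1 ++ w2, subst_word c a w1 = rcons p (flip c)
                  & subst_word c a w2 = s].
Proof.
elim: w p => [|d w IH] p; first by case: p.
rewrite subst_cons => /flip_nseq_split[[p' -> /IH [w1 [w2 [-> D1 D2]]]]|].
  by exists (d :: w1), w2; rewrite subst_cons D1 rcons_cat.
case=> j [l [Dk -> /(@flip_nseq_inj c 0) [Dl ->]]].
exists [:: d], w; split=> //.
by rewrite subst_cons Dk -Dl addn0 cats1.
Qed.

(** Maximal runs of [c] have length [a] or [a.+1], so a run longer than [a] is the complete run of
    the image of a [Y] and starts at a block boundary. *)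
Lemma subst_long_run c a w p k s :
  a < k -> subst_word c a w = p ++ nseq k c ++ s ->
  k = a.+1 /\ exists w1 w2, [/\ w = w1 ++ Y :: w2, subst_word c a w1 = p
                              & s = flip c :: subst_word c a w2].
Proof.
move=> lt_ak; elim: w p => [|d w IH] p.
  by case: p => //; case: k lt_ak.
rewrite subst_cons => /flip_nseq_split[[p' -> /IH [Dk [w1 [w2 [-> D1 D2]]]]]|].
  by split=> //; exists (d :: w1), w2; rewrite subst_cons D1.
case=> j [l [Dl -> Ds]]; have le_kl := flip_nseq_cat (esym Ds).
case: d Dl => Dl; first by move: Dl; rewrite addn0; lia.
have [j0 [Dk El]]: j = 0 /\ k = a.+1 /\ l = a.+1.
  by move: Dl; rewrite eqxx; lia.
split=> //; exists [::], w; split=> //; first by rewrite j0.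
by move/eqP: Ds; rewrite Dk El eqseq_cat // eqxx => /eqP.
Qed.

(** * Balance and its preservation by the substitution *)

(* The factors [X U X] and [Y U Y] may be longer than [B] here; compare
   [short_balanced], which is the condition of [property_pp]. *)
Definition balanced (B : type0_word) := forall U,
  cyclic_factor (X :: rcons U X) B -> cyclic_factor (Y :: rcons U Y) B -> False.

Lemma balanced_conjugate B C : conjugate B C -> balanced B -> balanced C.
Proof.
by move=> /conjugate_sym BC bal U hX hY;
  apply: (bal U); apply: cyclic_factor_conjugate BC _.
Qed.

(** The factor [flip c U flip c] aligns [U] with the blocks, and [c U c] lengthens the two outer
    runs of [U] by one. These runs then have length [a] in the former and [a.+1] in the latter,
    which yields [X v X] and [Y v Y] as factors for [w]. *)
Lemma balanced_subst c a w : balanced w -> balanced (subst_word c a w).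
Proof.
move=> bal U hX hY.
have [hc hf]: cyclic_factor (c :: rcons U c) (subst_word c a w) /\
  cyclic_factor (flip c :: rcons U (flip c)) (subst_word c a w).
  by case: c hX hY.
case: hf hc => m; rewrite -flatten_map_power => /infixP [p [s Df]].
case=> m'; rewrite -flatten_map_power => /infixP [p' [s' Dc]].
rewrite /= cat_rcons in Df.
have [w1 [w2 [Dw _]]] := subst_split_flip Df.
move=> /subst_split_flip [v [w3 [Dw2 Dv _]]].
have inf_v: infix v (power w m) by rewrite Dw Dw2 infix_infix.
move: Dc; rewrite -/(subst_word c a (power w m')) => Dc.
case: v Dv inf_v {Df Dw Dw2} => [|d v]; first by case: (U).
case/lastP: v => [|v e] Dv inf_v.
  (* For a single letter, [U] is a run of length at least [a], and [c U c] would be a run of length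
     at least [a + 2]. *)
  move: Dv; rewrite subst_cons cats1 => /rcons_inj [DU].
  rewrite -DU /= rcons_nseq -[_ :: _]/(nseq _.+2 _ ++ _) in Dc.
  by have [] := subst_long_run _ Dc; lia.
have {Dv} DU: U = nseq (a + (d == Y)) c ++ flip c :: subst_word c a v
                    ++ nseq (a + (e == Y)) c.
  apply: (@rcons_injl _ (flip c)); rewrite -Dv -!cats1 subst_cons subst_cat.
  by rewrite subst_cons /= -!catA /= -!catA.
have {}Dc: subst_word c a (power w m') = p' ++ nseq (a + (d == Y)).+1 c ++
    flip c :: subst_word c a v ++ nseq (a + (e == Y)).+1 c ++ s'.
  rewrite Dc DU -(rcons_nseq c (a + (e == Y))) -!cats1 /= -!catA /=.
  by rewrite -!catA.
(* The first run of [c U c] exceeds [a], so it comes from a [Y] and [d] is [X]; after the blocks of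
   [v], the last run is treated alike. *)
have [|Dd [w4 [w5 [Dw _ [/esym D5]]]]] := subst_long_run _ Dc; first by lia.
have [w6 {}D5 D6] := subst_split_prefix D5.
have [|De [w7 [w8 [D7 /subst_eq0 D8 _]]]] :=
  @subst_long_run _ _ _ [::] (a + (e == Y)).+1 _ _ D6; first by lia.
have Ed: d = X by case: (d) Dd => //=; lia.
have Ee: e = X by case: (e) De => //=; lia.
apply: (bal v); first by exists m; rewrite Ed Ee in inf_v.
exists m'; apply/infixP; exists w4, w8.
by rewrite Dw D5 D7 D8 /= cat_rcons.
Qed.

Lemma balanced1 c : balanced [:: c].
Proof.
move=> U [m /infixP [p [s D]]] [m' /infixP [p' [s' D']]].
have all_c k d : d \in power [:: c] k -> d = c.
  by elim: k => //= k IH; rewrite inE => /orP[/eqP|/IH].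
have Xc: X = c by apply: (all_c m); rewrite D mem_cat inE eqxx orbT.
suff: Y = c by rewrite -Xc.
by apply: (all_c m'); rewrite D' mem_cat inE eqxx orbT.
Qed.

Definition short_balanced (B : type0_word) := forall U V W,
  conjugate B (X :: U ++ X :: V) -> conjugate B (Y :: U ++ Y :: W) -> False.

Lemma short_balanced_flip B c U V W : short_balanced B ->
  conjugate B (c :: U ++ c :: V) ->
  conjugate B (flip c :: U ++ flip c :: W) -> False.
Proof.
by case: c => bal hU hV; [apply: bal hU hV | apply: bal hV hU].
Qed.

Lemma short_balanced_conjugate B C :
  conjugate B C -> short_balanced B -> short_balanced C.
Proof.
move=> BC bal U V W hU hV.
by apply: (bal U V W); apply: conjugate_trans BC _.
Qed.

Lemma property_ppP B : 0 < size B -> property_pp B <-> short_balanced B.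
Proof.
move=> B_gt0; have rotated W U V : conjugate B (W ++ U ++ V) ->
    rotated_subpattern U B.
  move=> BC; have szB := perm_size (conjugate_perm BC).
  have [|i lt_i D] := (@rot_equivP (W ++ U ++ V) B _).2 (conjugate_sym BC).
    by rewrite -szB.
  by exists i; rewrite // /subpattern -D infix_infix.
have rotatedl c U V : conjugate B (c :: U ++ c :: V) -> rotated_subpattern U B.
  exact: (rotated [:: c]).
have rotatedr c U V : conjugate B (c :: U ++ c :: V) -> rotated_subpattern V B.
  move=> BC; apply: (rotated (c :: rcons U c) V [::]).
  by rewrite cats0 /= cat_rcons.
split=> bal U V.
  move=> W hU hW; apply: (bal U V _ _ _ W); rewrite ?rot_equivP //.
  - exact: rotatedl hU.
  - exact: rotatedr hU.
  exact: rotatedr hW.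
move=> _ _; rewrite rot_equivP // => hU W _; rewrite rot_equivP // => hW.
exact: bal hU hW.
Qed.

Lemma balanced_short B : balanced B -> short_balanced B.
Proof.
move=> bal U V W hU hV.
have factor c V' : conjugate B (c :: U ++ c :: V') ->
    cyclic_factor (c :: rcons U c) B.
  move/conjugate_sym/cyclic_factor_conjugate; apply.
  exists 1; apply/infixP; exists [::], V'.
  by rewrite /power /= cats0 cat_rcons.
by apply: (bal U); apply: factor; [exact: hU | exact: hV].
Qed.

(** * Desubstitution of balanced words *)

Lemma conjugate_runs c ks ks' :
  conjugate ks ks' -> conjugate (runs c ks) (runs c ks').
Proof. exact: conjugate_flatten_map. Qed.

Lemma rcons_runs c s : exists ks, rcons s (flip c) = runs c ks.
Proof.
elim: s => [|d s [ks IH]]; first by exists [:: 0].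
rewrite rcons_cons IH; case: (block_eq_or_flip c d) => ->; last first.
  by exists (0 :: ks).
case: ks IH => [|k ks] IH; first by case: (s) IH.
by exists (k.+1 :: ks); rewrite !runs_cons.
Qed.

Lemma shortest_run_first c B : flip c \in B ->
  exists a ks, conjugate B (runs c (a :: ks)) /\ all (leq a) ks.
Proof.
move=> /splitPr [p q].
have [ks Dks] := rcons_runs c (q ++ p).
have ks_gt0: exists k, k \in ks.
  case: ks Dks => [|k ks _]; first by case: (q ++ p).
  by exists k; rewrite inE eqxx.
case: (ex_minnP ks_gt0) => a a_in min_a.
case/splitPr: a_in Dks min_a => ks1 ks2 Dks min_a.
exists a, (ks2 ++ ks1); split; last first.
  apply/allP => k; rewrite mem_cat orbC => k_in; apply: min_a.
  by rewrite mem_cat inE orbCA k_in orbT.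
apply: (@conjugate_trans _ (runs c (ks1 ++ a :: ks2))).
  by rewrite -Dks rcons_cat -cat_rcons; apply: conjugate_catC.
by apply: conjugate_runs; rewrite -cat_cons; apply: conjugate_catC.
Qed.

(** Moving the last letter to the front encloses the first run between two occurrences of [flip c],
    distinct because there is a second run. *)
Lemma conjugate_two_flips c a ks : ks != [::] ->
  exists V, conjugate (runs c (a :: ks)) (flip c :: nseq a c ++ flip c :: V).
Proof.
case/lastP: ks => // ks k _; exists (runs c ks ++ nseq k c).
rewrite runs_cons runs_rcons -cats1.
exists (nseq a c ++ flip c :: runs c ks ++ nseq k c), [:: flip c].
by rewrite /= -!catA /= -!catA.
Qed.

(** If the shortest runs of both letters were empty, [XX] and [YY] would contradict balance with [U]
    empty. For [c] with shortest run [a > 0], a run of length at least [a + 2] contains [c c^a c],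
    against [flip c c^a flip c]. *)
Lemma short_balanced_desubst B :
  short_balanced B -> X \in B -> Y \in B ->
  exists c a w, conjugate B (subst_word c a w) /\ 0 < a /\ size w < size B.
Proof.
move=> bal inX inY.
have two_flips c a ks : c \in B -> conjugate B (runs c (a :: ks)) -> a = 0 ->
  exists V, conjugate B (flip c :: [::] ++ flip c :: V).
  move=> c_in conj a0; rewrite {}a0 in conj.
  case: ks conj => [|k ks] conj.
    move: c_in; rewrite (perm_mem (conjugate_perm conj)) inE.
    by rewrite flip_neq.
  have [//|V /(conjugate_trans conj)] := @conjugate_two_flips c 0 (k :: ks) _.
  by exists V.
have [c [a [ks [a_gt0 conj min_a]]]] : exists c a ks,
    [/\ 0 < a, conjugate B (runs c (a :: ks)) & all (leq a) ks].
  have [aX [ksX [conjX minX]]] := @shortest_run_first X B inY.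
  have [aY [ksY [conjY minY]]] := @shortest_run_first Y B inX.
  have [aX0|aX_gt0] := posnP aX; last by exists X, aX, ksX.
  have [aY0|aY_gt0] := posnP aY; last by exists Y, aY, ksY.
  have [V hV] := @two_flips X aX ksX inX conjX aX0.
  have [W hW] := @two_flips Y aY ksY inY conjY aY0.
  (* An empty run of [X] gives [YY] and an empty run of [Y] gives [XX], hence the order of [W] and
     [V]. *)
  by case: (bal [::] W V).
have max_a k : k \in ks -> k <= a.+1.
  move=> k_in; rewrite leqNgt; apply/negP => lt_ak.
  have [|V /(conjugate_trans conj) hV] := @conjugate_two_flips c a ks _.
    by case: (ks) k_in.
  (* This splits the run as [c c^a c c^j]. *)
  have [j Dk]: exists j, k = a.+1 + j.+1 by exists (k - a.+2); lia.
  case/splitPr: k_in conj hV => ks1 ks2 conj hV.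
  suff: conjugate B (c :: nseq a c ++ c :: nseq j c ++
      flip c :: runs c (ks2 ++ a :: ks1)).
    by move=> hU; apply: short_balanced_flip bal hU hV.
  apply: conjugate_trans conj _.
  apply: (@conjugate_trans _ (runs c (k :: ks2 ++ a :: ks1))).
    by apply: conjugate_runs; exists (a :: ks1), (k :: ks2).
  rewrite runs_cons Dk nseqD -catA; exact: conjugate_refl.
exists c, a, [seq if k == a then X else Y | k <- a :: ks].
rewrite substE -map_comp (_ : map _ _ = a :: ks); last first.
  rewrite -[RHS]map_id; apply/eq_in_map => k; rewrite inE => k_in /=.
  have: a <= k <= a.+1.
    case/predU1P: k_in => [->|k_in]; first by rewrite leqnn leqnSn.
    by rewrite (allP min_a) ?max_a.
  by case: ifP => [/eqP ->|/eqP] /=; lia.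
split=> //; split=> //.
by rewrite size_map (perm_size (conjugate_perm conj)) size_runs /=; lia.
Qed.

(** Let [P] be [c^a flip c s(U) c^a], with [s] the substitution. The image of [Y U Y] contains
    [c P c]; that of [X U X], preceded by the [flip c] ending the image of [V], gives
    [flip c P flip c]. *)
Lemma short_balanced_subst_inv c a w :
  short_balanced (subst_word c a w) -> short_balanced w.
Proof.
move=> bal U V W hU hW.
case/lastP: V hU => [|V d] hU.
  (* [V] cannot be empty, since the two factorizations would contain different numbers of [Y]. *)
  have /permP/(_ (pred1 Y)) :=
    conjugate_perm (conjugate_trans (conjugate_sym hU) hW).
  by rewrite /= !count_cat /=; lia.
apply: (@short_balanced_flip _ c
  (nseq a c ++ flip c :: subst_word c a U ++ nseq a c)
  (flip c :: subst_word c a W)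
  (subst_word c a V ++ nseq (a + (d == Y)) c) bal).
  apply: conjugate_trans (subst_conjugate _ _ hW) _.
  rewrite subst_cons subst_cat subst_cons addn1 -{2}rcons_nseq -cats1.
  rewrite /= -!catA /= -!catA; exact: conjugate_refl.
apply: conjugate_trans (subst_conjugate _ _ hU) _.
rewrite subst_cons subst_cat subst_cons -(cats1 V) subst_cat subst_cons.
exists (nseq a c ++ flip c :: subst_word c a U ++ nseq a c ++ flip c ::
  subst_word c a V ++ nseq (a + (d == Y)) c), [:: flip c].
by rewrite addn0; split; do 4 rewrite -?catA /=.
Qed.

(** * Inductive words as iterated substitutions *)

Definition block_of (b : 'Z_2) : block := if b == 0%R then X else Y.

Lemma block_of_flip b : block_of (b + 1)%R = flip (block_of b).
Proof. by case: b => [[|[|]]]. Qed.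

Lemma block_of_surj c : exists b, block_of b = c.
Proof. by case: c; [exists 0%R | exists 1%R]. Qed.

Lemma Nword0 i a b : Nword i a 0 b = [:: block_of b].
Proof. by rewrite /= /block_of; case: ifP. Qed.

(* [Nword] is defined by unfolding the innermost substitution; the induction
   on words peels off the outermost one. *)
Lemma Nword_outer i a j b :
  Nword i a j.+1 b =
  subst_word (block_of (nth 0%R i 0)) (nth 0 a 0)
    (Nword (behead i) (behead a) j b).
Proof.
elim: j b => [|j IH] b.
  rewrite Nword0 /subst_word /= cats0 /subst_block -cats1.
  rewrite -!/(Nword i a 0 _) !Nword0 block_of_flip; congr (_ ++ _).
  rewrite /power /block_of; case: (b == _); rewrite ?addn0 ?addn1.
    by elim: (nth 0 a 0) => //= k ->.
  by elim: (_.+1) => //= k ->.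
rewrite [LHS]/= -!/(Nword i a j.+1 _) !IH [in RHS]/=.
by rewrite /subst_word map_cat flatten_cat flatten_map_power !nth_behead.
Qed.

Lemma balanced_Nword i a j b : balanced (Nword i a j b).
Proof.
elim: j i a => [|j IH] i a; first by rewrite Nword0; apply: balanced1.
by rewrite Nword_outer; apply: balanced_subst.
Qed.

(** For nonempty [w], the reversed image starts with the [flip c] that closed the image; moving it
    to the end gives the image of [rev w]. *)
Lemma conjugate_rev_subst c a w :
  conjugate (rev (subst_word c a w)) (subst_word c a (rev w)).
Proof.
have: rcons (rev (subst_word c a w)) (flip c) =
  flip c :: subst_word c a (rev w).
  elim: w => // d w IH.
  rewrite subst_cons rev_cat rev_cons rev_nseq IH rev_cons -(cats1 (rev w)).
  by rewrite subst_cat subst_cons /= rcons_cat cats1.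
case: (rev _) => [|e s] [].
  by move=> <-; apply: conjugate_refl.
by move=> -> <-; rewrite -cats1; apply: (conjugate_catC [:: _]).
Qed.

Lemma conjugate_rev_Nword i a j b :
  conjugate (rev (Nword i a j b)) (Nword i a j b).
Proof.
elim: j i a => [|j IH] i a; first by rewrite Nword0; apply: conjugate_refl.
rewrite Nword_outer; apply: conjugate_trans (conjugate_rev_subst _ _ _) _.
exact: subst_conjugate.
Qed.

(** Strong induction on the size: a word in one letter has length 1 by primitivity; any other is
    desubstituted, and primitivity and balance pass to the shorter word. *)
Lemma Nword_of_short_balanced B :
  0 < size B -> rot_primitive B -> short_balanced B ->
  exists i a b, [/\ size i = size a, all (leq 1) a
                  & conjugate B (Nword i a (size i) b)].
Proof.
have [k] := ubnP (size B); elim: k B => // k IH B lt_k B_gt0 prim bal.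
have one c : flip c \notin B -> exists i a b, [/\ size i = size a, all (leq 1) a
                  & conjugate B (Nword i a (size i) b)].
  move=> B_c; have [b Db] := block_of_surj c.
  exists [::], [::], b; split=> //; rewrite Nword0 Db.
  have DB: B = nseq (size B) c.
    apply/all_pred1P/allP => d d_in; apply/eqP.
    by case: (block_eq_or_flip c d) => // Dd; rewrite -Dd d_in in B_c.
  suff ->: B = [:: c] by apply: conjugate_refl.
  have [sz1|sz_gt1] := leqP (size B) 1.
    by rewrite DB; case: (size B) B_gt0 sz1 => [|[]].
  (* A longer constant word would be fixed by the rotation by 1. *)
  case: (prim 1); rewrite ?sz_gt1 // DB.
  by case: (size B) => // n; rewrite /rot /= take0 drop0 cats1 rcons_nseq.
have [inX|/(@one Y)//] := boolP (X \in B).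
have [inY|/(@one X)//] := boolP (Y \in B).
have [c [m [w [conj [m_gt0 lt_w]]]]] := short_balanced_desubst bal inX inY.
have [||||i [a [b [sz a_gt0 conj_w]]]] := IH w.
- by lia.
- case: w conj {lt_w} => // /conjugate_perm/perm_size; rewrite /subst_word /=.
  by lia.
- have := rot_primitive_conjugate conj prim.
  by apply: rot_primitive_flatten_map => d; rewrite size_rcons.
- exact: short_balanced_subst_inv (short_balanced_conjugate conj bal).
have [e De] := block_of_surj c.
(* The new substitution is the outermost one, so its parameters go to the heads of [i] and [a]. *)
exists (e :: i), (m :: a), b; split=> /=; rewrite ?sz ?m_gt0 //.
rewrite -/(Nword _ _ _.+1 _) Nword_outer /= De.
by apply: conjugate_trans conj _; apply: subst_conjugate; rewrite -sz.
Qed.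

(** * Wrap-arounds and reversal *)

(** With [n = size B], position [n - 1 - j] holds letter [j] of [B] in [rev B], and letter
    [omega - j] modulo [n] in the rotation. *)
Lemma wrap_aroundP (B : type0_word) (omega : 'I_(size B)) :
  allows_wrap_around omega <-> rev B = rot omega.+1 B.
Proof.
have lt_om := ltn_ord omega.
have wrap j : j < size B ->
    nth X (rot omega.+1 B) (size B - j.+1) =
    nth X B ((omega + size B - j) %% size B).
  by move=> lt_j; rewrite nth_rot //; [congr (nth _ _ (_ %% _)) |]; lia.
have rev_nth j : j < size B -> nth X (rev B) (size B - j.+1) = nth X B j.
  by move=> lt_j; rewrite nth_rev; [congr nth |]; lia.
split=> [wrapB | Drev i]; last by rewrite -rev_nth // Drev wrap.
apply: (@eq_from_nth _ X) => [|j]; rewrite size_rev ?size_rot // => lt_j.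
have lt_i: size B - j.+1 < size B by lia.
have ->: j = size B - (size B - j.+1).+1 by lia.
by rewrite rev_nth // wrap // (wrapB (Ordinal lt_i)).
Qed.

Lemma unique_wrap_around B : 0 < size B -> rot_primitive B ->
  conjugate (rev B) B -> exists! omega : 'I_(size B), allows_wrap_around omega.
Proof.
move=> B_gt0 prim /conjugateP[k Drev].
(* The identity counts as the rotation by [size B], not by 0, so that the amount is [m.+1] with
   [m < size B]. *)
have [m [lt_m Dm]] : exists m, m < size B /\ rev B = rot m.+1 B.
  have [/andP[k_gt0 lt_k]|k_out] := boolP (0 < k < size B).
    by exists k.-1; rewrite prednK // Drev; split=> //; lia.
  exists (size B).-1; rewrite prednK // rot_size Drev; split; first by lia.
  case: k {Drev} k_out => [|k] /=; first by rewrite rot0.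
  by rewrite -leqNgt => /rot_oversize.
exists (Ordinal lt_m); split; first by apply/wrap_aroundP.
move=> [m' lt_m'] /wrap_aroundP /= Dm'; apply: val_inj => /=.
have inj p q : p < q -> q < size B -> rot p.+1 B <> rot q.+1 B.
  move=> lt_pq lt_q; have ->: q.+1 = p.+1 + (q - p) by lia.
  rewrite rotD; last by lia.
  by move/rot_inj => /esym; apply: prim; lia.
by case: (ltngtP m m') => // /inj; rewrite -Dm -Dm' => /(_ _ erefl) [].
Qed.

(** * Primitivity of bands and the conclusion *)

(** A power of blocks is a power of letters, and since each block has 5 letters the size comparison
    carries over. *)
Lemma band_rot_primitive B :
  represents_band (word_of B) -> rot_primitive B.
Proof.
move=> band; apply: rot_primitiveP => w k lt_w DB.
have size_word C : size (word_of C) = 5 * size C.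
  by elim: C => // d C IH; rewrite /word_of /= size_cat IH; case: d => /=; lia.
apply: (@band_primitive _ band (word_of w) k).
  by rewrite !size_word ltn_mul2l.
by rewrite DB /word_of flatten_map_power.
Qed.

Theorem proposition4p4 (B : type0_word) (hB : standard_representative B) :
  (property_pp B <->
   exists (l : nat) (i : l.-1.-tuple 'Z_2) (a : l.-1.-tuple nat),
     0 < l /\ (forall k : 'I_l.-1, 0 < tnth a k) /\
     (rot_equiv B (xword i a) \/ rot_equiv B (yword i a))) /\
  (property_pp B ->
   exists! omega : 'I_(size B), allows_wrap_around omega).
Proof.
have [B_gt0 /band_rot_primitive prim] := hB; split; [split|].
- move=> /property_ppP bal.
  have [i [a [b [sz a_gt0 BN]]]] :=
    Nword_of_short_balanced B_gt0 prim (bal B_gt0).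
  have sz_a : size a == (size i).+1.-1 by rewrite sz.
  exists (size i).+1, (in_tuple i), (Tuple sz_a); split=> //; split.
    by move=> k; apply: (allP a_gt0); apply: mem_tnth.
  rewrite !rot_equivP // /xword /yword /=.
  have [b0|b1] : b = 0%R \/ b = 1%R.
    by case: b {BN} => [[|[|]]] // ?; [left | right]; apply: val_inj.
  + by left; rewrite -b0.
  + by right; rewrite -b1.
- move=> [l [i [a [_ [_ BN]]]]].
  apply/property_ppP => //; apply: balanced_short.
  by case: BN => /(rot_equivP _ B_gt0)/conjugate_sym/balanced_conjugate;
    apply; apply: balanced_Nword.
- move=> /property_ppP bal.
  have [i [a [b [_ _ BN]]]] := Nword_of_short_balanced B_gt0 prim (bal B_gt0).
  apply: unique_wrap_around => //.
  apply: conjugate_trans (conjugate_rev BN) _.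
  exact: conjugate_trans (conjugate_rev_Nword _ _ _ _) (conjugate_sym BN).
Qed.
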